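(* Let $M_1=x_0^{c}x_1^{a_1}\cdots x_n^{a_n}$ and $M_2=x_0^{c}x_1^{b_1}\cdots x_n^{b_n}$ be monomials of the same degree in $\mathbb{C}[x_0,\ldots,x_n]$ with $1\le c\le a_i$ and $1\le c\le b_i$ for $i=1,\ldots,n$. Let $M_{12}=\gcd(M_1,M_2)$. Suppose that, for each $i=1,\ldots,n$, either $|a_i-b_i|\in\{0,1\}$ or $|a_i-b_i|\ge c+1$. Then $$\mathrm{rk}_{\mathbb{C}}(M_1+M_2)\le\mathrm{rk}_{\mathbb{C}}\,M_1+\mathrm{rk}_{\mathbb{C}}\,M_2-\mathrm{rk}_{\mathbb{C}}\,M_{12}.$$
   Context: Here $n$ is a nonnegative integer. For a homogeneous polynomial $F\in\mathbb{C}[x_0,\ldots,x_n]$ of degree $d$, $\mathrm{rk}_{\mathbb{C}}\,F$ is its complex Waring rank, i.e. the minimal integer $r$ such that $F=\sum_{j=1}^r\lambda_jL_j^{d}$ for some linear forms $L_1,\ldots,L_r$ in $\mathbb{C}[x_0,\ldots,x_n]$ and $\lambda_j\in\mathbb{C}$. *)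

(* Defs.v *)
From mathcomp Require Import all_boot all_order all_algebra.
From mathcomp Require Import boolp reals.
From mathcomp.real_closed Require Import complex.
From mathcomp.multinomials Require Import mpoly.

Set Implicit Arguments.
Unset Strict Implicit.
Unset Printing Implicit Defensive.

Import GRing.Theory.
Local Open Scope ring_scope.

(* For R : realType, R[i] is the field of complex numbers. *)

(* msize is the total degree plus one for nonzero F, and 0 for F = 0. *)
Definition mpdegree (K : nzRingType) (N : nat) (F : {mpoly K[N]}) : nat :=
  (msize F).-1.

Section WaringRank.
Variables (K : comNzRingType) (N : nat).

Definition waring_decomposable (F : {mpoly K[N]}) (r : nat) : Prop :=
  exists (lambda : 'I_r -> K) (L : 'I_r -> {mpoly K[N]}),
    (forall j, L j \is 1.-homog) /\
    F = \sum_(j < r) lambda j *: L j ^+ mpdegree F.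

(* A homogeneous F over a field of characteristic 0 always has a Waring
   decomposition; the value 0 in the other branch is only there to make the
   function total. *)
Definition waring_rank (F : {mpoly K[N]}) : nat :=
  match pselect (exists r, `[< waring_decomposable F r >]) with
  | left F_decomposable => ex_minn F_decomposable
  | right _ => 0
  end.

Definition mpdvd (p q : {mpoly K[N]}) : Prop := exists s, q = s * p.

(* Defined up to a unit factor, as in any integral domain. *)
Definition is_mpgcd (p q g : {mpoly K[N]}) : Prop :=
  [/\ mpdvd g p, mpdvd g q & forall h, mpdvd h p -> mpdvd h q -> mpdvd h g].

End WaringRank.

(* The monomial x_0^c x_1^{a_1} ... x_n^{a_n}: a_1, ..., a_n are indexed by
   'I_n, and lift ord0 i : 'I_n.+1 has value i.+1. *)
Definition monomial (K : comNzRingType) (n c : nat) (a : 'I_n -> nat) :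
    {mpoly K[n.+1]} :=
  'X_ord0 ^+ c * \prod_(i < n) 'X_(lift ord0 i) ^+ a i.
Arguments monomial K {n} c a.

(* Main.v *)
(* The rank of [x_0^c x_1^{a_1} ... x_n^{a_n}] with [c <= a_i] is the product of
   the [a_i + 1].  It is at most that because [M] is a combination of the powers of
   the forms [x_0 + s_1 x_1 + ... + s_n x_n], with [s] in a grid whose i-th side is
   the root set of a squarefree polynomial [X^(a_i+1) + (terms of degree <= a_i-c)].
   When [a_i <= b_i], the polynomials [X^(a_i+1) - 1] and [(X^(a_i+1) - 1) g] with
   [g] equal to [1], [X] or [X^(b_i-a_i) - 2] give nested root sets of sizes
   [a_i + 1] and [b_i + 1]; the hypothesis on [|a_i - b_i|] is what makes one of
   these [g] admissible.  The grids of [M_1] and [M_2] then meet in a grid with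
   sides of size [min(a_i, b_i) + 1], and their union decomposes [M_1 + M_2]. *)
Require Import Defs.
From mathcomp Require Import all_boot all_order all_algebra all_field.
From mathcomp Require Import boolp reals.
From mathcomp.real_closed Require Import complex.
From mathcomp.multinomials Require Import mpoly.
From mathcomp Require Import zify ring.

Set Implicit Arguments.
Unset Strict Implicit.
Unset Printing Implicit Defensive.

Import Order.TTheory GRing.Theory Num.Theory.
Local Open Scope ring_scope.

(** * Coefficients of powers of linear forms *)

Section LinearForms.
Variables (K : numFieldType) (N : nat).
Implicit Types (l : 'I_N -> K) (m : 'X_{1..N}).

Definition linform l : {mpoly K[N]} := \sum_i l i *: 'X_i.

Lemma linform_homog l : linform l \is 1.-homog.
Proof.
by apply: rpred_sum => i _; apply: rpredZ; rewrite dhomogX /= mdeg1.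
Qed.

Lemma linformP (L : {mpoly K[N]}) :
  L \is 1.-homog -> L = linform (fun i => L@_U_(i)).
Proof.
move=> hL; apply/mpolyP => m.
rewrite raddf_sum /=.
have [|m1] := boolP (mdeg m == 1%N).
  move=> /mdeg1P[i /eqP->]; rewrite (bigD1 i) //= mcoeffZ mcoeffXU eqxx mulr1.
  by rewrite big1 ?addr0 // => j ji; rewrite mcoeffZ mcoeffXU (negPf ji) mulr0.
rewrite (dhomog_nemf_coeff hL m1) big1 // => i _.
by rewrite mcoeffZ mcoeffX; case: (U_(i)%MM =P m) m1 => [<-|]; rewrite ?mdeg1 // mulr0.
Qed.

Lemma linform_comp l :
  linform l = linform (fun=> 1) \mPo [tuple l i *: 'X_i | i < N].
Proof.
rewrite raddf_sum /=; apply: eq_bigr => i _.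
by rewrite comp_mpolyZ comp_mpolyXU -tnth_nth tnth_mktuple scale1r.
Qed.

(** Substituting [l i *: 'X_i] for ['X_i] scales the coefficient of ['X_[m]] by the value of that
    monomial at [l]. The other factor is a multinomial coefficient, kept unevaluated. *)
Lemma mcoeff_linformX l d m :
  (linform l ^+ d)@_m =
    (linform (fun=> 1) ^+ d)@_m * \prod_i l i ^+ m i.
Proof.
have mpoX k : 'X_[k] \mPo [tuple l i *: 'X_i | i < N]
    = (\prod_i l i ^+ k i) *: 'X_[k] :> {mpoly K[N]}.
  rewrite comp_mpolyX [in RHS]mpolyXE_id -mul_mpolyC rmorph_prod -big_split /=.
  by apply: eq_bigr => i _; rewrite tnth_mktuple exprZn -mul_mpolyC.
rewrite linform_comp -rmorphXn /=.
move: (linform _ ^+ d) => p; rewrite comp_mpolyEX [in RHS](mpolyE p).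
rewrite !raddf_sum /= mulr_suml; apply: eq_bigr => k _.
rewrite mpoX !mcoeffZ mcoeffX -mulrA; congr (_ * _).
by case: eqP => [->|]; rewrite ?mulr1 ?mul1r ?mulr0 ?mul0r.
Qed.

Lemma mcoeff_sumX_ge0 d m : 0 <= (linform (fun=> 1) ^+ d)@_m.
Proof.
elim: d m => [|d IHd] m; first by rewrite expr0 mcoeff1 ler0n.
rewrite exprSr mcoeffM sumr_ge0 // => k _; rewrite mulr_ge0 //.
by rewrite raddf_sum sumr_ge0 //= => i _; rewrite scale1r mcoeffX ler0n.
Qed.

(** Positivity permits division by multinomial coefficients, both in the apolar pairing and in the
    choice of weights. *)
Lemma mcoeff_sumX_gt0 m : 0 < (linform (fun=> 1) ^+ mdeg m)@_m.
Proof.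
move: {2}(mdeg m) (erefl (mdeg m)) => d.
elim: d m => [|d IHd] m.
  by move=> /eqP; rewrite mdeg_eq0 => /eqP->; rewrite mdeg0 expr0 mcoeff1 eqxx ltr01.
move=> md; have [i mi] : exists i, (0 < m i)%N.
  apply/existsP; apply: contraTT isT => /existsPn m0.
  by rewrite -(ltn0Sn d) -md mdegE big1 // => i _; have := m0 i; lia.
have mE : m = (U_(i) + (m - U_(i)))%MM.
  by apply/mnmP => j; rewrite mnmDE mnmBE mnm1E; case: eqP => [<-|]; lia.
have md' : mdeg (m - U_(i)) = d.
  by move: md; rewrite mE mdegD mdeg1 add1n -mE => -[].
rewrite md exprSr {2}/linform mulr_sumr raddf_sum /= (bigD1 i) //= scale1r.
rewrite {1}mE mcoeffMX ltr_wpDr //; last by rewrite -[in X in _ ^+ X]md' IHd.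
apply: sumr_ge0 => j _; rewrite scale1r mcoeffM sumr_ge0 // => k _.
by rewrite mulr_ge0 ?mcoeff_sumX_ge0 // mcoeffX ler0n.
Qed.

End LinearForms.

(** * Exponent vectors with a distinguished variable *)

Section MonomialExponents.
Variables (n : nat).
Implicit Types (c : nat) (a : 'I_n -> nat).

Definition mexp c a : 'X_{1..n.+1} :=
  [multinom oapp a c (unlift ord0 i) | i < n.+1].

Lemma mexp0 c a : mexp c a ord0 = c.
Proof. by rewrite mnmE unlift_none. Qed.

Lemma mexp_lift c a i : mexp c a (lift ord0 i) = a i.
Proof. by rewrite mnmE liftK. Qed.

Lemma mexp_eta (m : 'X_{1..n.+1}) :
  m = mexp (m ord0) (fun i => m (lift ord0 i)).
Proof.
by apply/mnmP => i; case: (unliftP ord0 i) => [j|] ->; rewrite ?mexp0 ?mexp_lift.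
Qed.

Lemma mdeg_mexp c a : mdeg (mexp c a) = (c + \sum_i a i)%N.
Proof.
rewrite mdegE big_ord_recl mexp0; congr addn.
by apply: eq_bigr => i _; rewrite mexp_lift.
Qed.

Lemma prod_mexp (K : comNzRingType) c a (l : 'I_n.+1 -> K) :
  \prod_i l i ^+ mexp c a i
  = l ord0 ^+ c * \prod_i l (lift ord0 i) ^+ a i.
Proof.
rewrite big_ord_recl mexp0; congr (_ * _).
by apply: eq_bigr => i _; rewrite mexp_lift.
Qed.

Lemma monomialE (K : comNzRingType) c a : monomial K c a = 'X_[mexp c a].
Proof. by rewrite mpolyXE_id prod_mexp. Qed.

(** In a fixed degree the exponent of [x_0] is determined by the others. *)
Lemma eq_mexp_mdeg c a (m : 'X_{1..n.+1}) : mdeg m = mdeg (mexp c a) ->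
  (mexp c a == m) = [forall i, m (lift ord0 i) == a i].
Proof.
rewrite [in mdeg m](mexp_eta m) !mdeg_mexp => md.
apply/eqP/forallP => [<- i|ma]; first by rewrite mexp_lift.
have sma : \sum_i m (lift ord0 i) = \sum_i a i :> nat.
  by apply: eq_bigr => i _; apply/eqP.
apply/mnmP => i; case: (unliftP ord0 i) => [j|] ->.
  by rewrite mexp_lift (eqP (ma j)).
by apply/esym/eqP; rewrite mexp0 -(eqn_add2r (\sum_i a i)) -md sma.
Qed.

End MonomialExponents.

(** * Waring decompositions as moment problems *)

Section Decompositions.
Variables (K : numFieldType) (N : nat).

(** Comparing coefficients leaves a moment problem: the points [l j] with weights [w j] must have,
    up to multinomial factors, the coefficients of [F] as moments of degree [d]. *)
Lemma waring_decomposableP (F : {mpoly K[N]}) (r d : nat) :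
    F \is d.-homog -> mpdegree F = d ->
  waring_decomposable F r <->
  exists (w : 'I_r -> K) (l : 'I_r -> 'I_N -> K), forall m, mdeg m = d ->
    F@_m = (linform (fun=> 1) ^+ d)@_m * \sum_j w j * \prod_i l j i ^+ m i.
Proof.
move=> hF dF; split=> [[w [L [hL FE]]]|[w [l FE]]].
  exists w, (fun j i => (L j)@_U_(i)) => m md.
  rewrite {1}FE dF raddf_sum mulr_sumr; apply: eq_bigr => j _ /=.
  by rewrite mcoeffZ {1}(linformP (hL j)) [in LHS]mcoeff_linformX mulrCA.
exists w, (fun j => linform (l j)); split=> [j|]; first exact: linform_homog.
rewrite dF; apply/mpolyP => m; have [md|md] := eqVneq (mdeg m) d; last first.
  rewrite (dhomog_nemf_coeff hF md) raddf_sum big1 // => j _ /=.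
  rewrite mcoeffZ (dhomog_nemf_coeff (dhomogMn d (linform_homog (l j)))) ?mulr0 //.
  by rewrite mul1n.
rewrite FE // raddf_sum mulr_sumr; apply: eq_bigr => j _ /=.
by rewrite mcoeffZ [in RHS]mcoeff_linformX mulrCA.
Qed.

End Decompositions.

(** * Boxes of multi-indices *)

Section Box.
Variables (n D : nat).
Implicit Types (a b : 'I_n -> nat).

(** The common bound [D] puts boxes with different sides in one finite type, where they can be
    intersected and united. *)
Definition box a : {set {ffun 'I_n -> 'I_D}} := 
  [set f : {ffun 'I_n -> 'I_D} | [forall i, f i <= a i]%N].

Lemma card_ord_le k : (k < D)%N -> #|[pred j : 'I_D | (j <= k)%N]| = k.+1.
Proof.
move=> kD; rewrite -[RHS](card_ord k.+1) -!sum1_card.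
by rewrite [RHS](big_ord_widen D (fun=> 1%N) kD).
Qed.

Lemma mem_box_family a f :
  (f \in box a) = (f \in family (fun i => [pred j : 'I_D | j <= a i]%N)).
Proof. by rewrite inE; apply: eq_forallb => i. Qed.

Lemma card_box a : (forall i, a i < D)%N -> #|box a| = (\prod_i (a i).+1)%N.
Proof.
move=> aD; rewrite (eq_card (mem_box_family a)) card_family foldrE big_map.
by rewrite big_enum; apply: eq_bigr => i _; apply: card_ord_le.
Qed.

Lemma boxI a b : box a :&: box b = box (fun i => minn (a i) (b i)).
Proof.
apply/setP => f; rewrite !inE; apply/andP/forallP => [[/forallP fa /forallP fb] i|fab].
  by rewrite leq_min fa fb.
by split; apply/forallP => i; have := fab i; rewrite leq_min => /andP[].
Qed.

Lemma sum_box (K : comNzRingType) a (F : 'I_n -> nat -> K) :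
    (forall i, a i < D)%N ->
  \sum_(f in box a) \prod_i F i (f i) = \prod_i \sum_(j < (a i).+1) F i j.
Proof.
move=> aD; under [RHS]eq_bigr => i _ do rewrite (big_ord_widen D (F i) (aD i)).
by rewrite bigA_distr_big_dep; apply: eq_bigl => f; rewrite mem_box_family.
Qed.

End Box.

(** * Lower bound for the rank of a monomial *)

Lemma monomial_homog (K : comNzRingType) n c (a : 'I_n -> nat) :
  monomial K c a \is (c + \sum_i a i).-homog.
Proof. by rewrite monomialE dhomogX /= mdeg_mexp. Qed.

Lemma mpdegree_homog (K : numFieldType) N d (F : {mpoly K[N]}) :
  F \is d.-homog -> F != 0 -> mpdegree F = d.
Proof.
move=> hF F0; apply/esym/(dhomog_uniq F0 hF); rewrite /mpdegree.
exact: (dhomog_msize hF).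
Qed.

(* If [r] is too small, some polynomial [g] with exponents in the box [<= a]
   vanishes at all the points [l j / l j 0] with [l j 0 != 0].  Homogenizing [g]
   and multiplying it by [y_0] gives a form apolar to all the [L j ^ d], hence to
   the monomial, which contradicts the presence in [g] of a term of top degree,
   here the one of index [s]. *)
Lemma monomial_rank_ge (K : numFieldType) n c (a : 'I_n -> nat) r :
    (0 < c)%N -> waring_decomposable (monomial K c a) r ->
  (\prod_i (a i).+1 <= r)%N.
Proof.
move=> c0 Mr.
have aD i : (a i < (\sum_i a i).+1)%N by rewrite ltnS (bigD1 i) //= leq_addr.
set d := (c + \sum_i a i)%N; set D := (\sum_i a i).+1 in aD.
rewrite -(card_box aD) leqNgt; apply/negP => r_lt.
have hM := monomial_homog K c a.
have dM : mpdegree (monomial K c a) = d.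
  by rewrite (mpdegree_homog hM) // monomialE -msize_poly_eq0 msizeX.
have [w [l ME]] := (waring_decomposableP r hM dM).1 Mr.
pose sz (f : {ffun 'I_n -> 'I_D}) := (\sum_i f i)%N.
pose ev (t : 'I_#|box D a|) : {ffun 'I_n -> 'I_D} := enum_val t.
pose p j (i : 'I_n) := l j (lift ord0 i) / l j ord0.
pose A := \matrix_(s < #|box D a|, j < r)
  \prod_i p j i ^+ ev s i.
(* The entries of [v] are the coefficients of [g]; [v] exists because [A] has more rows than
   columns. *)
have /rowV0Pn[v /sub_kermxP vA v0] : kermx A != 0.
  by rewrite kermx_eq0 /row_free ltn_eqF // (leq_ltn_trans (rank_leq_col A)).
have /rV0Pn[s0 vs0] := v0.
pose s := [arg max_(s > s0 | v 0 s != 0) sz (ev s)].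
pose e := sz (ev s).
have [vs smax] : v 0 s != 0 /\ forall t, v 0 t != 0 -> (sz (ev t) <= e)%N.
  by rewrite /e /s; case: arg_maxnP.
pose fs := ev s.
have fsa i : (fs i <= a i)%N.
  by have := enum_valP s; rewrite inE => /forallP/(_ i).
(* The term [ev t] of [g] is homogenized to degree [e], then multiplied by [y_0^c] and the
   [y_i^(a_i - fs_i)]. The total degree becomes [d], and the term [s] lands exactly on the exponent
   of the monomial. *)
pose gam t : 'X_{1..n.+1} := mexp (c + (e - sz (ev t)))
  (fun i => a i - fs i + ev t i)%N.
have gamd t : v 0 t != 0 -> mdeg (gam t) = d.
  move=> /smax te; rewrite /d mdeg_mexp big_split /= -/(sz (ev t)).
  have <- : (\sum_i (a i - fs i) + e = \sum_i a i)%N.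
    by rewrite /e /sz -big_split; apply: eq_bigr => i _; rewrite /= subnK.
  by rewrite -addnA; congr addn; rewrite addnCA subnK.
have gamE t : v 0 t != 0 -> (mexp c a == gam t) = (t == s).
  move=> vt; rewrite eq_mexp_mdeg ?(gamd _ vt) ?mdeg_mexp //.
  apply/forallP/eqP => [ta|-> i]; last first.
    by rewrite mexp_lift subnK.
  apply/enum_val_inj/ffunP => i; apply: val_inj.
  have /eqP := ta i; rewrite mexp_lift; have := fsa i.
  change (fs i <= a i -> a i - fs i + ev t i = a i -> ev t i = fs i :> nat)%N.
  by lia.
pose N t := (linform (fun=> 1 : K) ^+ d)@_(gam t).
have N0 t : v 0 t != 0 -> N t != 0.
  by move=> vt; rewrite /N -(gamd _ vt) gt_eqF // mcoeff_sumX_gt0.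
(* This is the apolar pairing with the monomial: only [t = s] contributes, and its contribution is
   nonzero. *)
suff : \sum_t v 0 t / N t * (monomial K c a)@_(gam t) = 0.
  rewrite (bigD1 s) //= big1 => [|t ts]; last first.
    have [->|vt] := eqVneq (v 0 t) 0; first by rewrite !mul0r.
    by rewrite monomialE mcoeffX gamE // (negPf ts) mulr0.
  rewrite monomialE mcoeffX gamE // eqxx mulr1 addr0 => /eqP.
  by rewrite mulf_eq0 invr_eq0 (negPf vs) (negPf (N0 _ vs)).
transitivity (\sum_t v 0 t * \sum_j w j * \prod_i l j i ^+ gam t i).
  apply: eq_bigr => t _; have [->|vt] := eqVneq (v 0 t) 0; first by rewrite !mul0r.
  by rewrite ME ?gamd // -/(N t) mulrA divfK ?N0.
under eq_bigr => t _ do rewrite mulr_sumr.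
rewrite exchange_big big1 //= => j _.
(* Here [p j] is a junk value, but each [gam t] contains [y_0] to a power at least [c > 0], so the
   point contributes nothing. *)
have [l0|l0] := eqVneq (l j ord0) 0.
  rewrite big1 // => t _; rewrite prod_mexp l0 exprD expr0n.
  by rewrite eqn0Ngt c0 !mul0r !mulr0.
have /matrixP/(_ 0 j) := vA; rewrite !mxE => vAj.
transitivity (w j * l j ord0 ^+ (c + e) * (\prod_i l j (lift ord0 i) ^+ (a i - fs i))
   * \sum_t v 0 t * A t j); last by rewrite vAj mulr0.
rewrite mulr_sumr; apply: eq_bigr => t _; rewrite mxE prod_mexp.
have [->|vt] := eqVneq (v 0 t) 0; first by rewrite !(mul0r, mulr0).
rewrite (eq_bigr (fun i => l j (lift ord0 i) ^+ (a i - fs i)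
  * l j (lift ord0 i) ^+ ev t i)); last first.
  by move=> i _; rewrite exprD.
rewrite big_split /= [X in _ = _ * (_ * X)](eq_bigr (fun i =>
    l j (lift ord0 i) ^+ ev t i
    * (l j ord0 ^- ev t i))); last first.
  by move=> i _; rewrite expr_div_n.
rewrite big_split /= prodfV prodrXr -/(sz (ev t)).
rewrite -{2}(subnK (smax t vt)) addnA !exprD.
move: (l j ord0 ^+ sz (ev t)) (expf_neq0 (sz (ev t)) l0) => x x0.
move: (v 0 t) (w j) (l j ord0 ^+ c) (l j ord0 ^+ (e - sz (ev t))) => u' u y z.
move: (\prod_i _ ^+ ev t i) (\prod_i _) => P Q.
by field.
Qed.

(** * Univariate quadratures with nested nodes *)

(** Lagrange interpolation: each basis polynomial [ell x] is monic of degree [m], so the weight of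
    [x] is the inverse of [(ell x).[x]]. *)
Lemma lagrange_top_coef (K : fieldType) (s : seq K) m :
    uniq s -> size s = m.+1 ->
  exists w : K -> K, forall p : {poly K}, (size p <= m.+1)%N ->
    \sum_(x <- s) w x * p.[x] = p`_m.
Proof.
move=> us ss; pose ell x := \prod_(y <- rem x s) ('X - y%:P).
have size_ell x : x \in s -> size (ell x) = m.+1.
  by move=> xs; rewrite size_prod_XsubC size_rem // ss.
exists (fun x => (ell x).[x]^-1) => p sp.
have ell0 x y : x \in s -> y \in s -> y != x -> (ell x).[y] = 0.
  move=> xs ys yx; apply/rootP.
  by rewrite root_prod_XsubC mem_rem_uniq // inE yx.
have ell_neq0 x : (ell x).[x] != 0.
  by rewrite -/(root _ _) root_prod_XsubC mem_rem_uniqF.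
pose q := p - \sum_(x <- s) ((ell x).[x]^-1 * p.[x]) *: ell x.
have q0 : q = 0.
  apply: (@roots_geq_poly_eq0 _ _ s) => //.
    apply/allP => y ys; rewrite rootE hornerD hornerN horner_sum.
    rewrite (bigD1_seq y) //= hornerZ mulrAC mulVf // mul1r.
    rewrite big_seq_cond big1 ?addr0 ?subrr // => x /andP[xs xy].
    by rewrite hornerZ (ell0 x y) ?mulr0 // eq_sym.
  rewrite ss (leq_trans (size_polyD _ _)) // geq_max sp size_polyN.
  rewrite (leq_trans (size_sum _ _ _)) //; apply/bigmax_leqP_seq => x xs _.
  by rewrite (leq_trans (size_scale_leq _ _)) ?size_ell.
move/eqP: q0; rewrite subr_eq0 => /eqP pE; rewrite [in RHS]pE coef_sum.
rewrite big_seq [RHS]big_seq; apply: eq_bigr => x xs; rewrite coefZ.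
have /monicP := monic_prod_XsubC (rem x s) predT id.
by rewrite /lead_coef -/(ell x) size_ell //= => ->; rewrite mulr1.
Qed.

(* The condition for [x^c y^a] to be, up to a scalar, the combination of the
   powers [(x + u j y)^(a+c)] with weights [w j]. *)
Definition quadrature (K : fieldType) (c a : nat) (u w : nat -> K) :=
  forall k, (k <= a + c)%N -> \sum_(j < a.+1) w j * u j ^+ k = (k == a)%:R.

(* With [f] the product of the [X - x], the power [X^(m+1+j)] with [j < c] has a
   remainder of degree less than [m] modulo [f]. *)
Lemma quadrature_roots (K : fieldType) (s t : seq K) m c :
    uniq s -> size s = m.+1 ->
    (forall k, (k <= m < k + c)%N -> (\prod_(x <- s) ('X - x%:P))`_k = 0) ->
  exists w, quadrature c m (nth 0 (s ++ t)) w.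
Proof.
move=> us ss; set f := \prod_(x <- s) _ => fgap.
have [w wE] := lagrange_top_coef us ss.
have fm : f`_m.+1 = 1.
  have /monicP: f \is monic by apply: monic_prod_XsubC.
  by rewrite /lead_coef (size_prod_XsubC s id) ss.
exists (fun j => w (nth 0 (s ++ t) j)) => k km.
transitivity (\sum_(x <- s) w x * x ^+ k).
  (* Only the first [m.+1] nodes are read, so [t] is mere padding; it lets a longer quadrature share
     the sequence. *)
  rewrite [RHS](big_nth 0) ss big_mkord; apply: eq_bigr => j _.
  by rewrite nth_cat ss ltn_ord.
have [km'|mk] := leqP k m.
  rewrite -[k == m]eq_sym -coefXn -wE ?size_polyXn //.
  by apply: eq_bigr => x _; rewrite hornerXn.
rewrite gtn_eqF //; pose j := (k - m.+1)%N.
(* [q] takes the value [x ^+ k] at each root [x] of [f], and the gap in [f] kills its coefficients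
   from index [m] on. *)
pose q := 'X^j * ('X^(m.+1) - f).
have qm i : (m <= i)%N -> q`_i = 0.
  rewrite coefXnM coefB coefXn => mi; case: ltnP => // ji.
  have [->|im] := eqVneq (i - j)%N m.+1; first by rewrite fm subrr.
  rewrite sub0r; apply/eqP; rewrite oppr_eq0; apply/eqP.
  have [im'|im'] := leqP (i - j) m; first by apply: fgap; rewrite /j in ji *; lia.
  by rewrite nth_default // size_prod_XsubC ss; lia.
transitivity q`_m; last exact: qm.
rewrite -wE; last by apply/leq_sizeP => i mi; apply: qm; lia.
rewrite big_seq [RHS]big_seq; apply: eq_bigr => x xs.
have /rootP fx : root f x by rewrite root_prod_XsubC.
by rewrite hornerM hornerD hornerN fx subr0 !hornerXn -exprD /j; congr (_ * _ ^+ _); lia.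
Qed.

(** As [v != 0], the polynomial is coprime to its derivative, a nonzero multiple of ['X^m]. *)
Lemma XnsubC_split (K : numClosedFieldType) (v : K) m : v != 0 ->
  exists2 s : seq K, uniq s & 'X^(m.+1) - v%:P = \prod_(x <- s) ('X - x%:P).
Proof.
move=> v0; have [s sE] := closed_field_poly_normal ('X^(m.+1) - v%:P).
rewrite lead_coefXnsubC // scale1r in sE; exists s => //.
rewrite -separable_prod_XsubC -sE separable_poly.unlock.
rewrite derivB derivC subr0 derivXn -scaler_nat coprimepZr ?pnatr_eq0 //.
rewrite coprimep_expr // -[X in coprimep _ X]subr0 -polyC0 coprimep_XsubC rootE.
by rewrite hornerD hornerN hornerXn hornerC expr0n sub0r oppr_eq0.
Qed.

(** Both quadratures read prefixes of one sequence [u]: the roots [s] of ['X^(a.+1) - 1], followed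
    by the roots [t] of the extra factor. *)
Lemma nested_quadratures (K : numClosedFieldType) c a b :
    (c <= a)%N -> (a <= b)%N ->
    b = a \/ b = a.+1 \/ (c < b - a)%N ->
  exists u w w' : nat -> K, quadrature c a u w /\ quadrature c b u w'.
Proof.
move=> ca ab gap.
have [s us sE] := XnsubC_split a (oner_neq0 K).
have ss : size s = a.+1.
  by apply: succn_inj; rewrite -(size_prod_XsubC s id) -sE size_XnsubC.
have s_root x : (x \in s) = (x ^+ a.+1 == 1).
  rewrite -root_prod_XsubC -sE rootE.
  by rewrite hornerD hornerN hornerXn hornerC subr_eq0.
suff [t [ut st tgap]] : exists t : seq K,
    [/\ uniq (s ++ t), size (s ++ t) = b.+1 & forall k, (k <= b < k + c)%N ->
      (\prod_(x <- s ++ t) ('X - x%:P))`_k = 0].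
  have [w' Qb] := quadrature_roots [::] ut st tgap; rewrite cats0 in Qb.
  have [|w Qa] := @quadrature_roots _ s t a c us ss; last first.
    by exists (nth 0 (s ++ t)), w, w'.
  move=> k kac; rewrite -sE coefB coefXn coefC ltn_eqF; last by lia.
  by rewrite gtn_eqF ?subrr //; lia.
have [->|ba] := eqVneq b a.
  exists [::]; rewrite cats0; split=> // k kac.
  rewrite -sE coefB coefXn coefC ltn_eqF; last by lia.
  by rewrite gtn_eqF ?subrr //; lia.
have [ba1|ba1] := eqVneq b a.+1.
  exists [:: 0]; rewrite cat_uniq size_cat ss ba1 addn1 us /= orbF s_root.
  rewrite expr0n /= eq_sym oner_eq0; split=> // k kac.
  rewrite big_cat big_seq1 -sE /= subr0 coefMX coefB coefXn coefC.
  by case: k kac => // k kac /=; rewrite ltn_eqF ?gtn_eqF ?subrr //; lia.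
have {}gap : (c < b - a)%N by case: gap => [|[]] //; lia.
have [e be] : exists e, b = (a + e.+1)%N by exists (b - a).-1; lia.
(* The constant 2 keeps the two root sets disjoint: a common root would force [2 ^ a.+1 = 1]. *)
have two0 : 2%:R != 0 :> K by rewrite pnatr_eq0.
have [t ut tE] := XnsubC_split e two0.
have st : size t = e.+1.
  by apply: succn_inj; rewrite -(size_prod_XsubC t id) -tE size_XnsubC.
exists t; split.
- rewrite cat_uniq us ut andbT /=; apply/hasPn => x.
  rewrite -root_prod_XsubC -tE rootE hornerD hornerN hornerXn hornerC subr_eq0.
  rewrite s_root => /eqP x2; apply/eqP => x1.
  have : (2%:R : K) ^+ a.+1 = 1 by rewrite -x2 -exprM mulnC exprM x1 expr1n.
  rewrite -natrX => /eqP; rewrite -[1]/(1%:R) eqr_nat expnS.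
  by have := expn_gt0 2 a; lia.
- by rewrite size_cat ss st; lia.
(* The product has lower terms in degrees [a+1], [b-a] and [0]; the first is at most [b-c] because
   [c < b-a], the second because [c <= a]. *)
move=> k kac; rewrite big_cat -sE -tE /= mulrBl mulrBr mul1r -exprD.
rewrite !coefB !coefXn coefMC coefXn coefC.
rewrite ltn_eqF ?(@gtn_eqF a.+1) ?(@gtn_eqF e.+1) ?(@gtn_eqF 0) //; try lia.
by rewrite mul0r !subr0.
Qed.

(** * Decompositions supported on grids *)

Section Grid.
Variables (K : numFieldType) (n c D : nat) (u : 'I_n -> nat -> K).

Definition grid_point (f : {ffun 'I_n -> 'I_D}) (i : 'I_n.+1) : K :=
  oapp (fun j => u j (f j)) 1 (unlift ord0 i).

(** Since the [x_0]-coordinate is 1, the sum factors into univariate moments. An exponent below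
    [a i] gives a zero factor; otherwise the degree condition forces every exponent into the range
    [a i] to [a i + c] covered by the quadratures. *)
Lemma grid_moment a (w : 'I_n -> nat -> K) m :
    (forall i, a i < D)%N -> (forall i, quadrature c (a i) (u i) (w i)) ->
    mdeg m = mdeg (mexp c a) ->
  \sum_(f in box D a) (\prod_i w i (f i)) * \prod_i grid_point f i ^+ m i
    = (mexp c a == m)%:R.
Proof.
move=> aD Qa md; rewrite eq_mexp_mdeg //.
pose k (i : 'I_n) := m (lift ord0 i).
transitivity (\sum_(f in box D a) \prod_i (w i (f i) * u i (f i) ^+ k i)).
  apply: eq_bigr => f _; rewrite big_split /=; congr (_ * _).
  rewrite big_ord_recl /grid_point unlift_none expr1n mul1r.
  by apply: eq_bigr => i _; rewrite liftK.
rewrite (sum_box (fun i j => w i j * u i j ^+ k i)) //.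
have [[i ki]|ka] := pselect (exists i, k i < a i)%N.
  rewrite (bigD1 i) //= Qa ?(ltnW (leq_trans ki _)) ?leq_addr // ltn_eqF //.
  rewrite mul0r; case: forallP => // /(_ i); rewrite -/(k i).
  by rewrite ltn_eqF.
have {}ka i : (a i <= k i)%N by rewrite leqNgt; apply/negP => ki; apply: ka; exists i.
have kac i : (k i <= a i + c)%N.
  have : (\sum_i k i <= c + \sum_i a i)%N.
    by rewrite -mdeg_mexp -md [in mdeg m](mexp_eta m) mdeg_mexp leq_addl.
  rewrite (bigD1 i) //= [X in (_ <= _ + X)%N](bigD1 i) //=.
  have : (\sum_(j | j != i) a j <= \sum_(j | j != i) k j)%N by apply: leq_sum.
  move=> s_ak /leq_trans le; rewrite -(leq_add2r (\sum_(j | j != i) k j)) le //.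
  by rewrite addnA [(c + _)%N]addnC leq_add2l.
rewrite (eq_bigr (fun i => (k i == a i)%:R)) => [|i _]; last exact: Qa.
case: forallP => [ke|/forallP]; first by rewrite big1 // => i _; rewrite (ke i).
by rewrite negb_forall => /existsP[i /negPf ki]; rewrite (bigD1 i) //= ki mul0r.
Qed.

(** General scalars cover both uses: [x = y = 1] for the sum, and [b = a] with [y = 0] for a
    multiple of a single monomial. *)
Lemma grid_decomposition a b (wa wb : 'I_n -> nat -> K) x y :
    (forall i, a i < D)%N -> (forall i, b i < D)%N ->
    (forall i, quadrature c (a i) (u i) (wa i)) ->
    (forall i, quadrature c (b i) (u i) (wb i)) ->
    \sum_i a i = \sum_i b i :> nat ->
    x *: monomial K c a + y *: monomial K c b != 0 ->
  waring_decomposable (x *: monomial K c a + y *: monomial K c b)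
    #|box D a :|: box D b|.
Proof.
move=> aD bD Qa Qb sab F0; set F := _ + _ in F0 *.
pose d := (c + \sum_i a i)%N.
have da : mdeg (mexp c a) = d by rewrite mdeg_mexp.
have db : mdeg (mexp c b) = d by rewrite mdeg_mexp -sab.
have hF : F \is d.-homog.
  apply: rpredD; apply: rpredZ; first exact: monomial_homog.
  by rewrite /d sab; apply: monomial_homog.
apply/(waring_decomposableP _ hF (mpdegree_homog hF F0)).
pose N (m : 'X_{1..n.+1}) := (linform (fun=> 1 : K) ^+ d)@_m.
have N0 m : mdeg m = d -> N m != 0 by move=> md; rewrite /N -md gt_eqF ?mcoeff_sumX_gt0.
(* Weights are extended by zero outside their own box and divided by the multinomial coefficient. *)
pose V (a' : 'I_n -> nat) (z : K) (w : 'I_n -> nat -> K) (f : {ffun 'I_n -> 'I_D}) :=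
  (f \in box D a')%:R * (z / N (mexp c a') * \prod_i w i (f i) : K).
pose G := box D a :|: box D b.
have VE a' z w m : (forall i, a' i < D)%N ->
    (forall i, quadrature c (a' i) (u i) (w i)) -> box D a' \subset G ->
    mdeg (mexp c a') = d -> mdeg m = d ->
  (z *: monomial K c a')@_m
    = N m * \sum_(f in G) V a' z w f * \prod_i grid_point f i ^+ m i.
  move=> a'D Qa' sG da' dm; rewrite mcoeffZ monomialE mcoeffX.
  rewrite (big_setID (box D a')) /= (setIidPr sG) [X in _ + X]big1; last first.
    by move=> f /setDP[_ /negPf fa]; rewrite /V fa !mul0r.
  rewrite addr0 (eq_bigr (fun f : {ffun 'I_n -> 'I_D} => z / N (mexp c a') *
      ((\prod_i w i (f i)) * \prod_i grid_point f i ^+ m i))); last first.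
    by move=> f fa; rewrite /V fa mul1r mulrA.
  rewrite -mulr_sumr grid_moment ?da' //.
  have [<-|am] := eqVneq (mexp c a') m; last by rewrite !mulr0.
  by rewrite !mulr1 mulrC divfK ?N0.
exists (fun j : 'I_#|G| => V a x wa (enum_val j) + V b y wb (enum_val j)).
exists (fun j : 'I_#|G| => grid_point (enum_val j)) => m dm.
rewrite mcoeffD (VE a _ wa) ?subsetUl // (VE b _ wb) ?subsetUr //.
rewrite -mulrDr -big_split /= -/(N m); congr (_ * _).
under eq_bigr do rewrite -mulrDl.
by rewrite (big_enum_val
  (fun f : {ffun 'I_n -> 'I_D} =>
    (V a x wa f + V b y wb f) * \prod_i grid_point f i ^+ m i)).
Qed.

End Grid.

(** * Rank bounds, the gcd and the final inequality *)

Lemma waring_rank_le (K : comNzRingType) N (F : {mpoly K[N]}) r :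
  waring_decomposable F r -> (waring_rank F <= r)%N.
Proof.
move=> Fr; rewrite /waring_rank; case: pselect => // Fdec.
by case: ex_minnP => k _; apply; apply/asboolP.
Qed.

(** The given decomposition excludes the branch where [waring_rank] takes its default value 0. *)
Lemma waring_rank_ge (K : comNzRingType) N (F : {mpoly K[N]}) r s :
    waring_decomposable F r ->
    (forall k, waring_decomposable F k -> (s <= k)%N) ->
  (s <= waring_rank F)%N.
Proof.
move=> Fr Fge; rewrite /waring_rank; case: pselect => [Fdec|[]].
  by case: ex_minnP => k /asboolP Fk _; apply: Fge.
by exists r; apply/asboolP.
Qed.

(** The cofactor [s] of the minimum monomial in [M] has a leading exponent bounded by both [a - m]
    and [b - m]. In each variable one of these vanishes, so [s] is constant. *)
Lemma mpgcd_monomial (K : fieldType) n c (a b : 'I_n -> nat) M :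
    is_mpgcd (monomial K c a) (monomial K c b) M ->
  exists2 k, k != 0 & M = k *: monomial K c (fun i => minn (a i) (b i)).
Proof.
set m := fun i => minn (a i) (b i) => -[[q Mq] [q' Mq'] Mgcd].
have split_mexp e : (forall i, m i <= e i)%N ->
    monomial K c e = 'X_[mexp 0 (fun i => e i - m i)%N] * monomial K c m.
  move=> me; rewrite !monomialE -mpolyXD; congr 'X_[_]; apply/mnmP => i.
  rewrite mnmDE; case: (unliftP ord0 i) => [j|] ->; first by rewrite !mexp_lift subnK.
  by rewrite !mexp0.
have ma i : (m i <= a i)%N by apply: geq_minl.
have mb i : (m i <= b i)%N by apply: geq_minr.
have [s sM] : mpdvd (monomial K c m) M.
  by apply: Mgcd; eexists; apply: split_mexp.
have X0 e : 'X_[e] != 0 :> {mpoly K[n.+1]} by rewrite -msize_poly_eq0 msizeX.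
have qs e p : (forall i, m i <= e i)%N -> monomial K c e = p * M ->
    s != 0 /\ (mlead s <= mexp 0 (fun i => e i - m i)%N)%MM.
  move=> me; rewrite split_mexp // sM mulrA => /mulIf.
  rewrite monomialE => /(_ (X0 _)) E.
  have := X0 (mexp 0 (fun i => e i - m i)%N).
  rewrite E mulf_eq0 negb_or => /andP[p0 s0]; split=> //.
  by rewrite -[X in (_ <= X)%MM](mleadXm K) E mleadM // lem_addl.
have [s0 sa] := qs _ _ ma Mq; have [_ sb] := qs _ _ mb Mq'.
have : mlead s = 0%MM.
  apply/mnmP => i; rewrite mnm0E.
  move/mnm_lepP: sa => /(_ i); move/mnm_lepP: sb => /(_ i).
  by case: (unliftP ord0 i) => [j|] ->; rewrite ?mexp_lift ?mexp0 /m; lia.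
move=> s1; have /msize_poly1P[k k0 sk] : msize s == 1%N.
  by rewrite -mlead_deg // s1 mdeg0.
by exists k => //; rewrite sM sk mul_mpolyC.
Qed.

Theorem corollary4p1 (R : realType) (n c : nat) (a b : 'I_n -> nat)
    (M12 : {mpoly R[i][n.+1]}) :
  let M1 := monomial R[i] c a in
  let M2 := monomial R[i] c b in
  mpdegree M1 = mpdegree M2 ->
  (1 <= c)%N ->
  (forall i, (c <= a i)%N) ->
  (forall i, (c <= b i)%N) ->
  is_mpgcd M1 M2 M12 ->
  (forall i, `|(a i)%:Z - (b i)%:Z|%N = 0%N
          \/ `|(a i)%:Z - (b i)%:Z|%N = 1%N
          \/ (c + 1 <= `|(a i)%:Z - (b i)%:Z|)%N) ->
  (waring_rank (M1 + M2))%:Z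
    <= (waring_rank M1)%:Z + (waring_rank M2)%:Z - (waring_rank M12)%:Z.
Proof.
move=> M1 M2 deg12 c0 ca cb gcd12 gap.
have [k k0 ->] := mpgcd_monomial gcd12.
set m := fun i => minn (a i) (b i).
have X0 (e : 'I_n -> nat) : monomial R[i] c e != 0.
  by rewrite monomialE -msize_poly_eq0 msizeX.
have sab : (\sum_i a i = \sum_i b i)%N.
  move: deg12; rewrite !(mpdegree_homog (monomial_homog _ _ _) (X0 _)).
  exact: addnI.
have nodes e f : (forall i, c <= e i)%N -> (forall i, c <= f i)%N ->
    (forall i, `|(e i)%:Z - (f i)%:Z|%N = 0%N \/ `|(e i)%:Z - (f i)%:Z|%N = 1%N
       \/ (c + 1 <= `|(e i)%:Z - (f i)%:Z|)%N) ->
  exists (u we wf : 'I_n -> nat -> R[i]), (forall i, quadrature c (e i) (u i) (we i))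
    /\ (forall i, quadrature c (f i) (u i) (wf i)).
  move=> ce cf ef.
  have /choice[g gP] : forall i, exists g : (nat -> R[i]) * (nat -> R[i]) * (nat -> R[i]),
      quadrature c (e i) g.1.1 g.1.2 /\ quadrature c (f i) g.1.1 g.2.
    (* Which exponent is the smaller depends on [i], so the nested pair is swapped where needed. *)
    move=> i; have [le|/ltnW le] := leqP (e i) (f i).
      have [|u [w [w' [Qe Qf]]]] := nested_quadratures R[i] (ce i) le.
        by have := ef i; lia.
      by exists (u, w, w').
    have [|u [w [w' [Qf Qe]]]] := nested_quadratures R[i] (cf i) le.
      by have := ef i; lia.
    by exists (u, w', w).
  exists (fun i => (g i).1.1), (fun i => (g i).1.2), (fun i => (g i).2).
  by split=> i; have [] := gP i.
pose D := (\sum_i (a i + b i)).+1.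
have abD i : (a i + b i < D)%N by rewrite ltnS (bigD1 i) //= leq_addr.
have aD i : (a i < D)%N by have := abD i; lia.
have bD i : (b i < D)%N by have := abD i; lia.
have mD i : (m i < D)%N by rewrite /m; have := aD i; lia.
have decomp (e : 'I_n -> nat) x :
    x != 0 -> (forall i, c <= e i)%N -> (forall i, e i < D)%N ->
    waring_decomposable (x *: monomial R[i] c e) #|box D e|.
  move=> x0 ce eD; have [i|u [w [_ [Qe _]]]] := nodes e e ce ce; first by left; lia.
  have := grid_decomposition (x := x) (y := 0) eD eD Qe Qe erefl.
  by rewrite scale0r addr0 setUid; apply; rewrite scaler_eq0 negb_or x0 X0.
have rank_ge (e : 'I_n -> nat) : (forall i, c <= e i)%N -> (forall i, e i < D)%N ->
    (#|box D e| <= waring_rank (monomial R[i] c e))%N.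
  move=> ce eD; apply: (@waring_rank_ge _ _ _ #|box D e|) => [|r].
    by rewrite -[monomial _ _ _]scale1r; apply: decomp; rewrite ?oner_neq0.
  by rewrite card_box //; apply: monomial_rank_ge.
have rank1 := rank_ge a ca aD; have rank2 := rank_ge b cb bD.
have rank12 : (waring_rank (k *: monomial R[i] c m) <= #|box D m|)%N.
  by apply/waring_rank_le/decomp => // i; rewrite leq_min ca cb.
have rank_sum : (waring_rank (M1 + M2) <= #|box D a :|: box D b|)%N.
  apply: waring_rank_le; have [u [wa [wb [Qa Qb]]]] := nodes a b ca cb gap.
  have := grid_decomposition (x := 1) (y := 1) aD bD Qa Qb sab.
  rewrite !scale1r; apply; apply: contraTneq isT => /(congr1 (mcoeff (mexp c a))).
  rewrite mcoeffD !monomialE !mcoeffX eqxx mcoeff0 -natrD => /eqP.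
  by rewrite pnatr_eq0.
(* Inclusion-exclusion for the boxes, with lower bounds for the ranks of [M1] and [M2] and upper
   bounds for those of the sum and the gcd, gives the inequality. *)
have card_sum := cardsUI (box D a) (box D b); rewrite boxI -/m in card_sum.
have ge1 : (#|box D a| <= waring_rank M1)%N by exact: rank1.
have ge2 : (#|box D b| <= waring_rank M2)%N by exact: rank2.
move: ge1 ge2 rank12 rank_sum card_sum.
move: #|box D a| #|box D b| #|box D m| #|_ :|: _| => A B C U.
move: (waring_rank M1) (waring_rank M2) => r1 r2.
move: (waring_rank (M1 + M2)) (waring_rank (k *: _)) => r12 r0.
by clear; lia.
Qed.
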